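(* Let $\mathcal F$ and $\mathcal G$ be sets of $n$-ary Boolean functions. Then the following are equivalent: (1) $\mathcal L(\mathcal G)\leq_{expr}\mathcal L(\mathcal F)$; (2) for each $g\in\mathcal G$ there is a set $S\subseteq\mathcal F$ such that $g\equiv\bigvee_{f\in S}f$ (as Boolean functions).
   Context: A Kripke model with $n$ modalities is $M=(W,R_1,\dots,R_n,\Pi)$ ($W\neq\emptyset$, $R_j\subseteq W\times W$, $\Pi$ a valuation of propositional variables); a pointed model is $(M,w)$. For $f\colon\{0,1\}^n\to\{0,1\}$, define $O_f(M,w)$ as the set of $w'$ with $f(r_1,\dots,r_n)=1$, where $r_j=1$ iff $(w,w')\in R_j$. For a set $\mathcal F$ of $n$-ary Boolean functions, $\mathcal L(\mathcal F)$ is the modal logic with formulas $\varphi::=p\mid\neg\varphi\mid\varphi\vee\varphi\mid[f]\varphi$ ($f\in\mathcal F$), usual semantics for $p,\neg,\vee$, and $M,w\models[f]\varphi$ iff $M,w'\models\varphi$ for all $w'\in O_f(M,w)$. Formulas are equivalent if they hold at the same pointed models. $\mathcal L_1\leq_{expr}\mathcal L_2$ means every $\mathcal L_1$-formula has an equivalent $\mathcal L_2$-formula. The empty disjunction is the constant $0$ function. *)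

(* Defs.v *)
From mathcomp Require Import all_boot.
From mathcomp Require Import boolp.
Set Implicit Arguments.
Unset Strict Implicit.
Unset Printing Implicit Defensive.

Definition boolfun (n : nat) := {ffun n.-tuple bool -> bool}.

Record kripke_model (n : nat) (PV : Type) := KripkeModel {
  world : Type;
  world_nonempty : inhabited world;
  acc : 'I_n -> world -> world -> Prop;
  valuation : PV -> world -> Prop
}.

(* The vector (r_1, ..., r_n), with r_j = 1 iff (w, w') is in R_j. *)
Definition profile (n : nat) (PV : Type) (M : kripke_model n PV)
    (w w' : world M) : n.-tuple bool :=
  [tuple `[< acc j w w' >] | j < n].

Definition O_set (n : nat) (PV : Type) (f : boolfun n) (M : kripke_model n PV)
    (w w' : world M) : Prop :=
  f (profile w w') = true.

(* There are only finitely many n-ary Boolean functions, so a finite set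
   [F : {set boolfun n}] is an arbitrary set of them. *)
Inductive formula (n : nat) (PV : Type) (F : {set boolfun n}) : Type :=
| Var of PV
| Neg of formula PV F
| Or of formula PV F & formula PV F
| Box (f : boolfun n) of f \in F & formula PV F.

Fixpoint sat (n : nat) (PV : Type) (F : {set boolfun n})
    (M : kripke_model n PV) (w : world M) (phi : formula PV F) : Prop :=
  match phi with
  | Var p => valuation p w
  | Neg psi => ~ sat w psi
  | Or psi chi => sat w psi \/ sat w chi
  | Box f _ psi => forall w' : world M, O_set f w w' -> sat w' psi
  end.

Definition equivalent (n : nat) (PV : Type) (F G : {set boolfun n})
    (phi : formula PV F) (psi : formula PV G) : Prop :=
  forall (M : kripke_model n PV) (w : world M), sat w phi <-> sat w psi.

(* L(F1) <=_expr L(F2), over the propositional variables [PV]. *)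
Definition le_expr (n : nat) (PV : Type) (F1 F2 : {set boolfun n}) : Prop :=
  forall phi : formula PV F1, exists psi : formula PV F2, equivalent phi psi.

(* Main.v *)
Require Import Defs.
From mathcomp Require Import all_boot.
From mathcomp Require Import boolp.

(** If [g] is the join of [S], then [[g]phi] is the conjunction of the
    [[f]phi] with [f] in [S].  Conversely, suppose [g r0] holds but no [f <= g]
    in [F] is true at [r0].  For a set [A] of profiles, consider the model whose
    worlds are coloured profiles, all profiles occurring in the colour true and
    those of [A] in the colour false, where every world sees [(c, r)] with
    profile [r] and the variables hold at the worlds of colour true.  For
    [A = {r | g r = 0}] the formula [[g]p] is valid; adding [r0] to [A] refutes
    it.  Yet every [f] in [F] with [f r0] also meets [{r | g r = 0}], so having
    the same colour is a bisimulation for [F] between the two models. *)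

Set Implicit Arguments.
Unset Strict Implicit.
Unset Printing Implicit Defensive.

Section ColouredModels.
Variables (n : nat) (PV : Type).
Implicit Types (A : pred (n.-tuple bool)) (F : {set boolfun n}).

Definition coloured A := {x : bool * n.-tuple bool | x.1 || A x.2}.

(** Colour true carries every profile, so this world exists even for empty [A]. *)
Definition coloured_point A : coloured A :=
  exist _ (true, [tuple of nseq n false]) isT.

Definition coloured_model A : kripke_model n PV :=
  @KripkeModel n PV (coloured A) (inhabits (coloured_point A))
    (fun j _ w => tnth (val w).2 j) (fun _ w => (val w).1).

Lemma profile_coloured A (u v : world (coloured_model A)) :
  profile u v = (val v).2.
Proof. by apply: eq_from_tnth => j; rewrite tnth_mktuple asboolb. Qed.

Lemma coloured_successor A A' (f : boolfun n)
    (w : world (coloured_model A)) (w' v' : world (coloured_model A')) :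
  ((exists2 r, A' r & f r) -> exists2 r, A r & f r) ->
  O_set f w' v' ->
  exists2 v : world (coloured_model A), O_set f w v & (val v).1 = (val v').1.
Proof.
rewrite /O_set profile_coloured => sAA'.
case: v' => -[c r] /= Acr fr.
(* In colour true the profile [r] itself is available; in colour false it may have to be exchanged
   for some [s] in [A] with [f s]. *)
case: c Acr => /= [_ | A'r].
  by exists (exist _ (true, r) isT); rewrite ?profile_coloured.
have [s As fs] := sAA' (ex_intro2 _ _ r A'r fr).
by exists (exist _ (false, s) As); rewrite ?profile_coloured.
Qed.

Lemma sat_same_colour F A A' :
  (forall f, f \in F -> (exists2 r, A r & f r) <-> exists2 r, A' r & f r) ->
  forall (phi : formula PV F)
         (w : world (coloured_model A)) (w' : world (coloured_model A')),
  (val w).1 = (val w').1 -> sat w phi <-> sat w' phi.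
Proof.
move=> AA'; elim=> [p|phi IH|phi IH1 psi IH2|f fF phi IH] w w' ww' /=.
- by rewrite ww'.
- by have := IH _ _ ww'; tauto.
- by have := IH1 _ _ ww'; have := IH2 _ _ ww'; tauto.
- split=> sat_succ v Ov.
  + have [u Ou uv] := coloured_successor w (AA' f fF).2 Ov.
    by apply/(IH _ _ uv)/sat_succ.
  + have [u Ou uv] := coloured_successor w' (AA' f fF).1 Ov.
    by apply/(IH _ _ (esym uv))/sat_succ.
Qed.

End ColouredModels.

Lemma box_join (n : nat) (PV : Type) (p : PV) (F : {set boolfun n})
    (s : seq (boolfun n)) (psi : formula PV F) :
  {subset s <= F} ->
  exists chi : formula PV F, forall (M : kripke_model n PV) (w : world M),
    sat w chi <->
    forall f, f \in s -> forall w', O_set f w w' -> sat w' psi.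
Proof.
elim: s => [|f s IH] sF.
  (* The empty conjunction is a tautology built from [p]. *)
  by exists (Or (Var F p) (Neg (Var F p))) => M w /=; split=> // _; apply: EM.
have [|chi chiP] := IH; first by move=> h hs; rewrite sF ?in_cons ?hs ?orbT.
have fF : f \in F by rewrite sF ?mem_head.
exists (Neg (Or (Neg (Box fF psi)) (Neg chi))) => M w /=.
rewrite chiP; split=> [/not_orP[/contrapT satf /contrapT sats] h | sats].
  by rewrite in_cons => /predU1P[-> | /sats].
case; apply; first by apply: sats; rewrite mem_head.
by move=> h hs; apply: sats; rewrite in_cons hs orbT.
Qed.

Lemma le_expr_of_join (n : nat) (PV : Type) (p : PV) (F G : {set boolfun n}) :
  (forall g : boolfun n, g \in G ->
     exists S : {set boolfun n}, S \subset F /\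
       forall r : n.-tuple bool, g r = \big[orb/false]_(f in S) f r) ->
  le_expr PV G F.
Proof.
move=> joinG; elim=> [q|phi [psi E]|phi1 [psi1 E1] phi2 [psi2 E2]|g gG phi [psi E]].
- by exists (Var F q).
- by exists (Neg psi) => M w /=; have := E M w; tauto.
- by exists (Or psi1 psi2) => M w /=; have := E1 M w; have := E2 M w; tauto.
have [S [/subsetP SF gS]] := joinG g gG.
have [|chi chiP] := @box_join n PV p F (enum S) psi.
  by move=> f; rewrite mem_enum; apply: SF.
exists chi => M w /=; rewrite chiP; split=> [satg f | sats w'].
  rewrite mem_enum => fS w' Of; apply/E/satg.
  by rewrite /O_set gS big_orE; apply/existsP; exists f; rewrite fS.
rewrite /O_set gS big_orE => /existsP[f /andP[fS Of]].
by apply/E/(sats f); rewrite ?mem_enum.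
Qed.

Lemma le_expr_below (n : nat) (PV : Type) (p : PV) (F G : {set boolfun n})
    (g : boolfun n) (r0 : n.-tuple bool) :
  le_expr PV G F -> g \in G -> g r0 ->
  exists2 f, f \in F & f r0 /\ forall r, f r -> g r.
Proof.
move=> leGF gG gr0; apply: contrapT => no_f.
have [psi E] := leGF (Box gG (Var G p)).
pose A r := ~~ g r; pose A' r := A r || (r == r0).
(* Only [r0] is new in [A']. An [f] true at [r0] that misses [A] would lie below [g], against
   [no_f]. *)
have AA' f : f \in F -> (exists2 r, A r & f r) <-> exists2 r, A' r & f r.
  move=> fF; split=> [[r Ar fr] | [r /orP[Ar|/eqP->] fr]].
  - by exists r; rewrite // /A' Ar.
  - by exists r.
  apply: contrapT => noA; apply: no_f; exists f => //; split=> // r' fr'.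
  by apply/negPn/negP => Ar'; apply: noA; exists r'.
(* In colour false [g] vanishes on all profiles, so [g] reaches only colour true. *)
have valid : sat (coloured_point A : world (coloured_model PV A)) (Box gG (Var G p)).
  move=> /= v; rewrite /O_set profile_coloured.
  by case: v => -[c r] /= /orP[|/negP].
have A'r0 : A' r0 by rewrite /A' eqxx orbT.
have : sat (coloured_point A' : world (coloured_model PV A')) (Box gG (Var G p)).
  have [sat_psi _] := sat_same_colour AA' psi
    (w := coloured_point A) (w' := coloured_point A') erefl.
  exact/E/sat_psi/E.
(* The added world is reached by [g] but falsifies [p]. *)
move/(_ (exist _ (false, r0) A'r0)).
by rewrite /O_set profile_coloured => /(_ gr0).
Qed.

Theorem theorem5 (n : nat) (PV : Type) (PV_nonempty : inhabited PV)
    (F G : {set boolfun n}) :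
  le_expr PV G F <->
  (forall g : boolfun n, g \in G ->
     exists S : {set boolfun n}, S \subset F /\
       forall r : n.-tuple bool, g r = \big[orb/false]_(f in S) f r).
Proof.
case: PV_nonempty => p; split=> [leGF g gG | ]; last exact: le_expr_of_join.
(* The largest candidate: every member of [F] below [g]. *)
exists [set f in F | [forall r, f r ==> g r]]; split.
  by apply/subsetP => f; rewrite inE => /andP[].
move=> r; rewrite big_orE; apply/idP/existsP => [gr | [f]].
  have [f fF [fr /= fg]] := le_expr_below p leGF gG gr.
  by exists f; rewrite inE fF fr andbT; apply/forallP => s; apply/implyP/fg.
by rewrite inE => /andP[/andP[_ /forallP/(_ r)/implyP]].
Qed.
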